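(* All inverse semigroup actions $(S,X,\alpha)$ on locally compact Hausdorff spaces $X$ and all proper action morphisms $(\theta,\xi)$ between them form a subcategory of the category $\mathbf{ISA}$ of inverse semigroup actions and action morphisms.
   Context: Partial maps: for topological spaces $X,Y$, a partial map $f\colon X\supset D_f\to Y$ is a continuous map from an open subspace $D_f\subset X$ to $Y$. For $V\subset Y$, $f^{-1}(V):=\{x\in D_f: f(x)\in V\}$. The composition of $f_1\colon X\supset D_{f_1}\to Y$ and $f_2\colon Y\supset D_{f_2}\to Z$ is $f_2\circ f_1\colon X\supset f_1^{-1}(D_{f_2})\to Z$. A partial map $f$ is proper if $f^{-1}(C)$ is compact for every compact $C\subset Y$. An inverse semigroup is a semigroup $S$ in which every $s$ has a unique $s^*$ with $ss^*s=s$, $s^*ss^*=s^*$. $I(X)$ is the inverse semigroup of all homeomorphisms between open subspaces of $X$, under composition of partial maps. An inverse semigroup action $(S,X,\alpha)$ consists of an inverse semigroup $S$, a topological space $X$ and a semigroup homomorphism $\alpha\colon S\to I(X)$, $s\mapsto\alpha_s$, such that $\bigcup_{s\in S}D^\alpha_s=X$, where $D^\alpha_s$ is the domain of $\alpha_s$. An action morphism $(\theta,\xi)\colon(S,X,\alpha)\to(T,Y,\beta)$ consists of a semigroup homomorphism $\theta\colon S\to T$ and a partial map $\xi\colon Y\supset D_\xi\to X$ such that (i) $\xi^{-1}(D^\alpha_s)=D^\beta_{\theta(s)}$ for every $s\in S$; (ii) $\alpha_s(\xi(y))=\xi(\beta_{\theta(s)}(y))$ for every $s\in S$ and $y\in\xi^{-1}(D^\alpha_s)$.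 It is proper if $\xi$ is a proper partial map. $\mathbf{ISA}$ is the category of all inverse semigroup actions and action morphisms, with composition $(\theta_2,\xi_2)\cdot(\theta_1,\xi_1):=(\theta_2\circ\theta_1,\xi_1\circ\xi_2)$ and identities $(\mathrm{id}_S,\mathrm{id}_X)$. *)

(* Defs.v *)
From HB Require Import structures.
From mathcomp Require Import all_boot monoid.
From mathcomp Require Import boolp classical_sets topology.

Set Implicit Arguments.
Unset Strict Implicit.
Unset Printing Implicit Defensive.

Local Open Scope classical_set_scope.

Record category := Category {
  obj :> Type;
  hom : obj -> obj -> Type;
  idm : forall A, hom A A;
  comp : forall A B C, hom B C -> hom A B -> hom A C;
  comp1m : forall A B (f : hom A B), comp (idm B) f = f;
  compm1 : forall A B (f : hom A B), comp f (idm A) = f;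
  compA : forall A B C D (h : hom C D) (g : hom B C) (f : hom A B),
    comp h (comp g f) = comp (comp h g) f }.

Arguments hom {c}.
Arguments idm {c}.
Arguments comp {c A B C}.

(* The class of objects [P] and the class of morphisms [Q] form a subcategory
   of [C]: [Q] is a class of arrows between objects of [P], and is closed under
   the identities and the composition of [C]. *)
Record is_subcategory (C : category) (P : C -> Prop)
    (Q : forall A B : C, hom A B -> Prop) : Prop := IsSubcategory {
  subcat_source : forall (A B : C) (f : hom A B), Q A B f -> P A;
  subcat_target : forall (A B : C) (f : hom A B), Q A B f -> P B;
  subcat_id : forall A : C, P A -> Q A A (idm A);
  subcat_comp : forall (A B D : C) (g : hom B D) (f : hom A B),
    Q B D g -> Q A B f -> Q A D (comp g f) }.

(* A partial map is encoded as [f : X -> option Y], where [f x = None] means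
   that [x] is outside the domain. *)
Definition odom (X Y : Type) (f : X -> option Y) : set X := [set x | f x].

Definition opreimage (X Y : Type) (f : X -> option Y) (V : set Y) : set X :=
  [set x | exists2 y, f x = Some y & V y].

(* The domain is open, so a subset of it is open in the subspace topology iff
   it is open in [X]; see [pmap_continuousP] for the comparison with the
   continuity of a function on a subspace. *)
Record pmap (X Y : topologicalType) := PMap {
  pfun :> X -> option Y;
  pdom_open : open (odom pfun);
  pfun_continuous : forall V : set Y, open V -> open (opreimage pfun V) }.

Notation pdom f := (odom (pfun f)).
Notation ppreimage f V := (opreimage (pfun f) V).

Lemma pmap_continuousP (X Y : topologicalType) (f : X -> option Y) :
  open (odom f) ->
  (forall V : set Y, open V -> open (opreimage f V)) <->
  (forall y0 : Y, {within odom f, continuous (fun x => odflt y0 (f x))}).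
Proof.
move=> oD; split=> [cf y0|cf V oV].
  rewrite continuous_open_subspace// => x /set_mem /= xD W /=.
  rewrite nbhsE => -[V [oV Vx] VW].
  have : nbhs x (opreimage f V).
    apply: open_nbhs_nbhs; split; first exact: cf.
    by move: xD Vx; rewrite /odom /=; case fx: (f x) => [y|] //= _ Vy; exists y.
  by apply: filterS => z [y fz Vy]; apply: VW; rewrite /= fz.
rewrite openE => x [y fx Vy].
have xD : odom f x by rewrite /odom /= fx.
have := cf y; rewrite continuous_open_subspace// => /(_ x (mem_set xD)).
move=> /(_ V) /=; rewrite fx /= => /(_ (open_nbhs_nbhs (conj oV Vy))) nV.
have nD : nbhs x (odom f) by exact: open_nbhs_nbhs.
apply: filterS (filterI (nV : nbhs x _) nD) => z [/= Vz]; rewrite /odom /=.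
by case fz: (f z) Vz => [w|] //= Vw _; exists w.
Qed.

Lemma pmap_eq (X Y : topologicalType) (f g : pmap X Y) : f =1 g -> f = g.
Proof.
case: f g => [f fo fc] [g go gc] /= /funext fg; subst g.
by congr PMap; exact: Prop_irrelevance.
Qed.

Section PMapComp.
Context {X Y Z : topologicalType} (f2 : pmap Y Z) (f1 : pmap X Y).

Let c x := obind f2 (f1 x).

Lemma opreimage_comp V : opreimage c V = ppreimage f1 (ppreimage f2 V).
Proof.
rewrite predeqE => x; rewrite /opreimage /c /=; split=> [[z]|[y -> [z fz Vz]]].
  by case: (f1 x) => //= y yz Vz; exists y => //; exists z.
by exists z.
Qed.

Lemma odom_comp : odom c = ppreimage f1 (pdom f2).
Proof.
rewrite predeqE => x; rewrite /odom /opreimage /c /=; split=> [|[y ->]//].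
by case: (f1 x) => //= y yD; exists y.
Qed.

Fact pcomp_open : open (odom c).
Proof. by rewrite odom_comp; apply/pfun_continuous/pdom_open. Qed.

Fact pcomp_continuous V : open V -> open (opreimage c V).
Proof. by move=> oV; rewrite opreimage_comp; do 2!apply: pfun_continuous. Qed.

Definition pcomp : pmap X Z := PMap pcomp_open pcomp_continuous.

End PMapComp.

Lemma pcompA (X Y Z T : topologicalType)
    (h : pmap Z T) (g : pmap Y Z) (f : pmap X Y) :
  pcomp h (pcomp g f) = pcomp (pcomp h g) f.
Proof. by apply: pmap_eq => x /=; case: (f x). Qed.

Section PMapId.
Context {X : topologicalType}.

Fact pid_open : open (odom (@Some X)).
Proof. by rewrite (_ : odom _ = setT) ?predeqE//; exact: openT. Qed.

Fact pid_continuous V : open V -> open (opreimage (@Some X) V).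
Proof.
rewrite (_ : opreimage _ V = V)// predeqE => x; rewrite /opreimage /=.
by split=> [[y [->]]|Vx] //; exists x.
Qed.

Definition pid : pmap X X := PMap pid_open pid_continuous.

End PMapId.
Arguments pid : clear implicits.

Definition proper_pmap (X Y : topologicalType) (f : pmap X Y) :=
  forall C : set Y, compact C -> compact (ppreimage f C).

(* [I(X)]: [f] is a homeomorphism from [pdom f] onto the open set [pdom g],
   with inverse [g]. *)
Record phomeo (X : topologicalType) := PHomeo {
  pmap_of_phomeo :> pmap X X;
  phomeo_inv : exists g : pmap X X,
    forall x y, pmap_of_phomeo x = Some y <-> g y = Some x }.

Lemma phomeo_eq (X : topologicalType) (f g : phomeo X) : f =1 g -> f = g.
Proof.
case: f g => [f fi] [g gi] /= /pmap_eq fg; subst g.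
by congr PHomeo; exact: Prop_irrelevance.
Qed.

Section PHomeoSemigroup.
Context {X : topologicalType}.
Implicit Types f g : phomeo X.

Fact phomeo_comp_inv f g : exists h : pmap X X,
  forall x y, pcomp f g x = Some y <-> h y = Some x.
Proof.
have [f' ff'] := phomeo_inv f; have [g' gg'] := phomeo_inv g.
exists (pcomp g' f') => x z; split=> /=.
  case gx: (g x) => [y|] //= /ff' ->.
  exact/gg'.
case fz: (f' z) => [y|] //= /gg' ->.
exact/ff'.
Qed.

Definition phomeo_comp f g : phomeo X := PHomeo (phomeo_comp_inv f g).

Fact phomeo_compA : associative phomeo_comp.
Proof. by move=> f g h; apply: phomeo_eq => x /=; case: (pfun h x). Qed.

End PHomeoSemigroup.

HB.instance Definition _ X := gen_eqMixin (phomeo X).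
HB.instance Definition _ X := gen_choiceMixin (phomeo X).
HB.instance Definition _ X := hasMul.Build (phomeo X) phomeo_comp.
HB.instance Definition _ X :=
  Magma_isSemigroup.Build (phomeo X) phomeo_compA.

Definition inverse_semigroup (S : semigroupType) :=
  forall s : S, exists! t : S, (s * t * s = s /\ t * s * t = t)%g.

Lemma phomeo_inverse_semigroup (X : topologicalType) :
  inverse_semigroup (phomeo X).
Proof.
move=> f; have [g fg] := phomeo_inv f.
have gi : exists h : pmap X X, forall x y, g x = Some y <-> h y = Some x.
  by exists f => x y; split=> /fg.
exists (PHomeo gi); split.
  split; apply: phomeo_eq => x /=.
    by case fx: (pfun f x) => [y|] //=; rewrite ((fg x y).1 fx).
  by case gx: (g x) => [y|] //=; rewrite ((fg y x).2 gx) /= gx.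
move=> t [ftf tft]; have [t' tt'] := phomeo_inv t.
have finj x x' y : f x = Some y -> f x' = Some y -> x = x'.
  by move=> /fg gy /fg; rewrite gy => -[].
have tinj x x' y : t x = Some y -> t x' = Some y -> x = x'.
  by move=> /tt' ty /tt'; rewrite ty => -[].
have gt y x : g y = Some x -> t y = Some x.
  move=> /fg fx; have /= := congr1 (fun h : phomeo X => h x) ftf.
  rewrite fx /=; case ty: (pfun t y) => [z|] //= fz.
  by rewrite (finj _ _ _ fz fx).
have tg y x : t y = Some x -> g y = Some x.
  move=> ty; have /= := congr1 (fun h : phomeo X => h y) tft.
  rewrite ty /=; case fx: (pfun f x) => [z|] //= tz.
  by apply/fg; rewrite fx (tinj _ _ _ tz ty).
apply: phomeo_eq => y /=.
case gy: (g y) => [x|]; first by rewrite (gt _ _ gy).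
by case ty: (pfun t y) => [x|] //; rewrite -gy (tg _ _ ty).
Qed.

Record isaction := ISAction {
  acts : semigroupType;
  acts_inverse : inverse_semigroup acts;
  actx : topologicalType;
  act :> {multiplicative acts -> phomeo actx};
  act_cover : \bigcup_(s in [set: acts]) pdom (act s) = setT }.

(* In [ism_equiv] the hypothesis on [y] makes the left-hand side defined, so
   the equation includes the fact that [b (ism_theta s) y] lies in the domain of
   [ism_xi]. *)
Record isamorphism (a b : isaction) := ISAMorphism {
  ism_theta : {multiplicative acts a -> acts b};
  ism_xi : pmap (actx b) (actx a);
  ism_dom : forall s : acts a,
    ppreimage ism_xi (pdom (a s)) = pdom (b (ism_theta s));
  ism_equiv : forall (s : acts a) (y : actx b),
    ppreimage ism_xi (pdom (a s)) y ->
    obind (a s) (ism_xi y) = obind ism_xi (b (ism_theta s) y) }.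

Lemma isamorphism_eq (a b : isaction) (f g : isamorphism a b) :
  ism_theta f =1 ism_theta g -> ism_xi f =1 ism_xi g -> f = g.
Proof.
case: f g => [[t [[tm]]] x fd fe] [[u [[um]]] y gd ge] /= tu /pmap_eq xy.
have {}tu : t = u by exact/funext.
subst u y.
have mm : tm = um by exact: Prop_irrelevance.
subst um.
by congr ISAMorphism; exact: Prop_irrelevance.
Qed.

Section ISACategory.

Fact ism_id_dom (a : isaction) (s : acts a) :
  ppreimage (pid (actx a)) (pdom (a s)) = pdom (a (idfun s)).
Proof.
rewrite predeqE => x; rewrite /opreimage /=.
by split=> [[y [->]]|xD] //; exists x.
Qed.

Fact ism_id_equiv (a : isaction) (s : acts a) (x : actx a) :
  ppreimage (pid (actx a)) (pdom (a s)) x ->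
  obind (a s) (pid (actx a) x) = obind (pid (actx a)) (a (idfun s) x).
Proof. by move=> _ /=; case: (pfun (a s) x). Qed.

Definition ism_id (a : isaction) : isamorphism a a :=
  @ISAMorphism a a idfun (pid _) (@ism_id_dom a) (@ism_id_equiv a).

Context (a b c : isaction) (g : isamorphism b c) (f : isamorphism a b).

Fact ism_comp_dom (s : acts a) :
  ppreimage (pcomp (ism_xi f) (ism_xi g)) (pdom (a s)) =
  pdom (c ((ism_theta g \o ism_theta f) s)).
Proof. by rewrite opreimage_comp !ism_dom. Qed.

Fact ism_comp_equiv (s : acts a) (z : actx c) :
  ppreimage (pcomp (ism_xi f) (ism_xi g)) (pdom (a s)) z ->
  obind (a s) (pcomp (ism_xi f) (ism_xi g) z) =
  obind (pcomp (ism_xi f) (ism_xi g)) (c ((ism_theta g \o ism_theta f) s) z).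
Proof.
rewrite opreimage_comp => -[y gz fy] /=.
have gD : ppreimage (ism_xi g) (pdom (b (ism_theta f s))) z.
  by exists y => //; rewrite -ism_dom.
have := ism_equiv gD; rewrite gz /= ism_equiv//.
move=> ->.
by case: (pfun (c _) z).
Qed.

Definition ism_comp : isamorphism a c :=
  @ISAMorphism a c (ism_theta g \o ism_theta f)
    (pcomp (ism_xi f) (ism_xi g)) ism_comp_dom ism_comp_equiv.

End ISACategory.

Fact ism_comp1m (a b : isaction) (f : isamorphism a b) :
  ism_comp (ism_id b) f = f.
Proof. exact: isamorphism_eq. Qed.

Fact ism_compm1 (a b : isaction) (f : isamorphism a b) :
  ism_comp f (ism_id a) = f.
Proof. by apply: isamorphism_eq => //= y; case: (pfun _ y). Qed.

Fact ism_compA (a b c d : isaction)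
    (h : isamorphism c d) (g : isamorphism b c) (f : isamorphism a b) :
  ism_comp h (ism_comp g f) = ism_comp (ism_comp h g) f.
Proof. by apply: isamorphism_eq => //= y; case: (pfun _ y). Qed.

Definition ISA : category := Category ism_comp1m ism_compm1 ism_compA.

Definition proper_isamorphism (a b : isaction) (f : isamorphism a b) :=
  proper_pmap (ism_xi f).

(* [locally_compact] asks for closed compact neighborhoods; in a Hausdorff
   space compact neighborhoods are closed. *)
Definition lch_isaction (a : isaction) :=
  locally_compact [set: actx a] /\ hausdorff_space (actx a).

(* Main.v *)
From mathcomp Require Import all_boot.
From mathcomp Require Import boolp classical_sets topology.
Require Import Defs.

(** Proper morphisms are closed under identities and composition because
preimages under partial maps are functorial: the identity pulls a compact set
back to itself, and a composite pulls it back in two steps ([opreimage_comp]),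
each of which keeps it compact.  Composing action morphisms composes their
partial maps in the opposite order, which does not matter as both factors are
proper.  The condition on the spaces concerns only the source and the target,
which a composite takes from its factors. *)

Lemma opreimage_some (X : Type) (V : set X) : opreimage (@Some X) V = V.
Proof.
rewrite predeqE => x; split=> [[y [->]]|Vx] //.
by exists x.
Qed.

Lemma proper_pid (X : topologicalType) : proper_pmap (pid X).
Proof. by move=> C cC; rewrite opreimage_some. Qed.

Lemma proper_pcomp (X Y Z : topologicalType) (f2 : pmap Y Z) (f1 : pmap X Y) :
  proper_pmap f2 -> proper_pmap f1 -> proper_pmap (pcomp f2 f1).
Proof. by move=> p2 p1 C cC; rewrite opreimage_comp; apply/p1/p2. Qed.

Theorem theorem3p8 :
  @is_subcategory ISA lch_isaction
    (fun a b f => lch_isaction a /\ lch_isaction b /\ proper_isamorphism f).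
Proof.
split=> [a b f []|a b f [_ []]|a aP|a b c g f [_ [cP gp]] [aP [_ fp]]] //.
  by do 2!split=> //; exact: proper_pid.
by do 2!split=> //; exact: proper_pcomp.
Qed.
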